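(* Let $\mathcal{X},\mathcal{Y}$ be finite-dimensional Euclidean spaces, $K:\mathcal{X}\to\mathcal{Y}$ a linear operator, and let $f$ on $\mathcal{Y}$ and $g$ on $\mathcal{X}$ be proper, convex, lower semicontinuous functions such that $f^*$ is $\mu_{f^*}$-strongly convex and $g$ is $\mu_g$-strongly convex. Let $(\hat{x},\hat{y})$ be the unique saddle point of $$\min_{x\in\mathcal{X}}\max_{y\in\mathcal{Y}}\ \langle Kx,y\rangle+g(x)-f^*(y).$$ Then for all $(x,y)\in\mathcal{X}\times\mathcal{Y}$, $$\|x-\hat{x}\|\le\frac{\|\nabla g(x)+K^*\nabla f(Kx)\|}{\mu_g},\qquad \|y-\hat{y}\|\le\frac{\|\nabla f^*(y)-K\nabla g^*(-K^*y)\|}{\mu_{f^*}},$$ where $\nabla g(x)$ and $\nabla f^*(y)$ denote arbitrary subgradients of $g$ at $x$ and of $f^*$ at $y$, respectively.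
   Context: $\|\cdot\|$ is the Euclidean norm, $K^*$ is the adjoint of $K$, and $f^*,g^*$ denote convex conjugates. Strong convexity of $f^*$ and $g$ implies that $f$ and $g^*$ are finite everywhere and differentiable with Lipschitz gradients, so $\nabla f(Kx)$ and $\nabla g^*(-K^*y)$ are genuine gradients. The bounds are understood at points $x$, $y$ where the respective subdifferentials $\partial g(x)$, $\partial f^*(y)$ are nonempty. *)

(* Defs.v *)
From HB Require Import structures.
From mathcomp Require Import all_boot all_order all_algebra.
From mathcomp Require Import all_classical all_reals.
From mathcomp Require Import ereal topology normedtype derive.

Set Implicit Arguments.
Unset Strict Implicit.
Unset Printing Implicit Defensive.

Import Order.TTheory GRing.Theory Num.Theory.
Import numFieldNormedType.Exports.

Local Open Scope classical_set_scope.
Local Open Scope ring_scope.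

(** Finite-dimensional real inner product spaces whose norm (and hence topology)
    is the one induced by the inner product. The standard ['rV[R]_n] is not an
    instance under its library norm, which is the sup norm. *)
HB.mixin Record NormedVector_isEuclidean (R : realType) X
    of NormedModule R X & Vector R X := {
  inner : X -> X -> R ;
  innerC : forall x y : X, inner x y = inner y x ;
  innerPl : forall (a : R) (x y z : X),
    inner (a *: x + y) z = a * inner x z + inner y z ;
  inner_norm : forall x : X, inner x x = `|x| ^+ 2
}.

#[short(type="euclideanType")]
HB.structure Definition Euclidean (R : realType) :=
  {X of NormedVector_isEuclidean R X & NormedModule R X & Vector R X}.

Section Operators.
Context {R : realType} {X Y : euclideanType R}.

(** Total by choice: [adjoint K y] is the unique [v] with
    [<K x, y> = <x, v>] for all [x]; it exists by the Riesz representation. *)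
Definition adjoint (K : {linear X -> Y}) (y : Y) : X :=
  get [set v : X | forall x : X, inner (K x) y = inner x v].

End Operators.

Section ConvexAnalysis.
Context {R : realType} {X : euclideanType R}.
Implicit Types (h : X -> \bar R) (x p : X) (mu : R).

Local Open Scope ereal_scope.

Definition eproper h : Prop :=
  (forall x, -oo < h x) /\ (exists x, h x < +oo).

Definition econvex h : Prop := forall x y (t : R), (0 < t < 1)%R ->
  h (t *: x + (1 - t) *: y)%R <= t%:E * h x + (1 - t)%:E * h y.

Definition strongly_convex mu h : Prop := forall x y (t : R), (0 < t < 1)%R ->
  h (t *: x + (1 - t) *: y)%R <=
    t%:E * h x + (1 - t)%:E * h y
    - (mu / 2 * (t * (1 - t)) * `|x - y| ^+ 2)%:E.

Definition conjugate h : X -> \bar R :=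
  fun p => ereal_sup [set (inner p x)%:E - h x | x in [set: X]].

Definition subdifferential h x : set X :=
  [set p | forall z, h x + (inner p (z - x))%:E <= h z].

(** [h] is required to be finite around [x], so that [fine \o h] is a faithful
    real-valued version of it there. *)
Definition is_gradient h x p : Prop :=
  [/\ \forall z \near x, h z \is a fin_num,
      differentiable (fine \o h : X -> R^o) x
    & forall v : X, 'd (fine \o h : X -> R^o) x v = inner p v].

(** The gradient when [h] is differentiable at [x]; unspecified otherwise. *)
Definition gradient h x : X := get (is_gradient h x).

End ConvexAnalysis.

Section SaddlePoint.
Context {R : realType} {X Y : euclideanType R}.

Local Open Scope ereal_scope.

(** The library convention [+oo - +oo = -oo] applies where [g x] and the
    conjugate of [f] at [y] are both [+oo]; it does not affect saddle points:
    for proper [g] and [conjugate f] these have finite [g x] and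
    [conjugate f y]. *)
Definition lagrangian (K : {linear X -> Y}) (f : Y -> \bar R) (g : X -> \bar R)
    (x : X) (y : Y) : \bar R :=
  (inner (K x) y)%:E + g x - conjugate f y.

Definition saddle_point (L : X -> Y -> \bar R) (x0 : X) (y0 : Y) : Prop :=
  forall (x : X) (y : Y), L x0 y <= L x0 y0 /\ L x0 y0 <= L x y0.

End SaddlePoint.

(* Main.v *)
Require Import Defs.
From HB Require Import structures.
From mathcomp Require Import all_boot all_order all_algebra.
From mathcomp Require Import all_classical all_reals.
From mathcomp Require Import ereal topology normedtype landau derive.
From mathcomp Require Import ring lra.

(**
  At a saddle point, [- adjoint K yhat] is a subgradient of [g] at [xhat] and
  [K xhat] one of [conjugate f] at [yhat]. Put [v := gradient f (K x)]; then
  [K x] is a subgradient of [conjugate f] at [v]. In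
    [<p + K^* v, x - xhat> = <p + K^* yhat, x - xhat> + <v - yhat, K x - K xhat>]
  strong monotonicity of the subdifferential of [g] bounds the first term below
  by [mu_g * |x - xhat|^2], and monotonicity of that of [conjugate f] makes the
  second one nonnegative; Cauchy-Schwarz concludes. The other bound is
  symmetric.

  The gradients must be shown to exist. Strongly convex lower semicontinuous
  functions have minimizers, because their minimizing sequences are Cauchy, so
  their subdifferentials are surjective; this handles [conjugate g]. For [f],
  let [w0] be such that [u] is a subgradient of [conjugate f] at [w0]. The
  proximal points [z] of [u], with subgradients [p := l *: (u - z)] of [f],
  satisfy [l * mu * |p - w0| <= |w0|] and [|p| <= |w0|], so that [z] tends to
  [u] and [p] to [w0] as [l] grows: [w0] is a subgradient of [f] at [u].
*)

Set Implicit Arguments.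
Unset Strict Implicit.
Unset Printing Implicit Defensive.

Import Order.TTheory GRing.Theory Num.Theory.
Import numFieldNormedType.Exports.

Local Open Scope classical_set_scope.
Local Open Scope ring_scope.

(** * Inner products: Cauchy-Schwarz, Riesz representation, completeness *)

Section InnerProduct.
Context {R : realType} {X : euclideanType R}.
Implicit Types (x y z : X) (a : R).

Lemma innerDl x y z : inner (x + y) z = inner x z + inner y z.
Proof. by have := innerPl 1 x y z; rewrite scale1r mul1r. Qed.

Lemma inner0l z : inner 0 z = 0.
Proof. by apply: (addrI (inner 0 z)); rewrite -innerDl !addr0. Qed.

Lemma innerZl a x z : inner (a *: x) z = a * inner x z.
Proof. by rewrite -[a *: x]addr0 innerPl inner0l addr0. Qed.

Lemma innerNl x z : inner (- x) z = - inner x z.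
Proof. by rewrite -scaleN1r innerZl mulN1r. Qed.

Lemma innerDr x y z : inner z (x + y) = inner z x + inner z y.
Proof. by rewrite !(innerC z) innerDl. Qed.

Lemma innerZr a x z : inner z (a *: x) = a * inner z x.
Proof. by rewrite !(innerC z) innerZl. Qed.

Lemma innerNr x z : inner z (- x) = - inner z x.
Proof. by rewrite !(innerC z) innerNl. Qed.

Definition innerE := (innerDl, innerDr, innerNl, innerNr, innerZl, innerZr).

Lemma inner_suml (I : Type) (r : seq I) (F : I -> X) z :
  inner (\sum_(i <- r) F i) z = \sum_(i <- r) inner (F i) z.
Proof.
elim: r => [|i r IH]; first by rewrite !big_nil inner0l.
by rewrite !big_cons innerDl IH.
Qed.

Lemma inner_ge0 x : 0 <= inner x x.
Proof. by rewrite inner_norm exprn_ge0. Qed.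

Lemma inner_eq0 x : inner x x = 0 -> x = 0.
Proof. by rewrite inner_norm => /eqP; rewrite sqrf_eq0 normr_eq0 => /eqP. Qed.

Lemma inner_le_norm x y : inner x y <= `|x| * `|y|.
Proof.
have [->|x0] := eqVneq x 0; first by rewrite inner0l normr0 mul0r.
have [->|y0] := eqVneq y 0; first by rewrite innerC inner0l normr0 mulr0.
have xp : 0 < `|x| by rewrite normr_gt0.
have yp : 0 < `|y| by rewrite normr_gt0.
(* Expanding this square leaves [2 * |x| * |y|] times the Cauchy-Schwarz defect. *)
have := inner_ge0 (`|y| *: x - `|x| *: y).
rewrite !innerE !inner_norm (innerC y x) => h.
have : 0 <= (`|x| * `|y|) * (`|x| * `|y| - inner x y) by lra.
by rewrite pmulr_rge0 ?mulr_gt0 // subr_ge0.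
Qed.

Lemma norm_inner_le x y : `|inner x y| <= `|x| * `|y|.
Proof.
rewrite ler_norml inner_le_norm andbT.
by have := inner_le_norm (- x) y; rewrite innerNl normrN lerNl.
Qed.

(** The Gram map [phi] of a basis is injective, hence invertible by finite dimension; the preimage
    of the vector with coordinates [l e_i] represents [l]. *)
Lemma riesz_representation (l : X -> R) :
  scalar l -> exists v, forall x, l x = inner x v.
Proof.
move=> lP; pose e := vbasis {:X}.
have eF : free e by apply: basis_free; exact: vbasisP.
have xE x : x = \sum_i coord e i x *: e`_i.
  by apply: coord_vbasis; rewrite memvf.
pose phi x : X := \sum_(i < \dim {:X}) inner x e`_i *: e`_i.
have phiP : linear phi.
  move=> a x y; rewrite /phi scaler_sumr -big_split /=; apply: eq_bigr => i _.
  by rewrite innerPl scalerDl scalerA.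
pose phiL : {linear X -> X} := HB.pack phi (GRing.isLinear.Build _ _ _ _ phi phiP).
pose lL : {scalar X} := HB.pack l (GRing.isLinear.Build _ _ _ _ l lP).
have coordphi x i : coord e i (phi x) = inner x e`_i.
  by rewrite /phi coord_sum_free.
have ker0 : lker (linfun phiL) == 0%VS.
  apply/lker0P => x y; rewrite !lfunE /= => xy.
  (* The difference [x - y] is orthogonal to every basis vector, hence to itself. *)
  apply/eqP; rewrite -subr_eq0; apply/eqP/inner_eq0.
  rewrite {1}(xE (x - y)) inner_suml big1 // => i _.
  rewrite innerZl innerC innerDl innerNl.
  by rewrite -!coordphi xy subrr mulr0.
pose t : X := \sum_(i < \dim {:X}) l e`_i *: e`_i.
have vP : phi ((linfun phiL)^-1%VF t) = t.
  by rewrite -[LHS](lfunE phiL) lker0_lfunVK.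
exists ((linfun phiL)^-1%VF t) => x.
rewrite -[LHS]/(lL x) {1 2}(xE x) linear_sum inner_suml; apply: eq_bigr => i _.
rewrite linearZ /= innerZl (innerC e`_i); congr (_ * _).
by rewrite -coordphi vP /t coord_sum_free.
Qed.

Lemma inner_continuous y : continuous (fun x => inner x y : R^o).
Proof.
move=> x; apply/cvgrPdist_le => e e0; near=> z.
rewrite -innerNl -innerDl (le_trans (norm_inner_le _ _)) //.
have : `|x - z| <= e / (`|y| + 1).
  near: z; apply: cvgr_dist_le; first exact: cvg_id.
  by rewrite divr_gt0 // ltr_wpDl.
rewrite ler_pdivlMr ?ltr_wpDl // => h; apply: le_trans h.
by rewrite ler_wpM2l // lerDl.
Unshelve. all: by end_near. Qed.

(** By Riesz each coordinate is an inner product with a fixed vector, hence Lipschitz, so it maps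
    [F] to a Cauchy filter on the reals; the coordinatewise limits assemble to a limit of [F]. *)
Lemma euclidean_complete (F : set_system X) : ProperFilter F ->
  cauchy F -> exists x, F --> x.
Proof.
move=> FF /cauchy_ballP Fc; pose e := vbasis {:X}.
have xE x : x = \sum_i coord e i x *: e`_i.
  by apply: coord_vbasis; rewrite memvf.
have coordC i : exists c : R^o, coord e i x @[x --> F] --> c.
  have [v vP] := riesz_representation (linearP (coord e i)).
  suff /cauchy_cvgP/cvg_ex : cauchy (coord e i x @[x --> F] : set_system R^o) by [].
  apply/cauchy_ballP => d d0.
  have /Fc [[A B] /= [FA FB] AB] : 0 < d / (`|v| + 1).
    by rewrite divr_gt0 // ltr_wpDl.
  exists (coord e i @` A, coord e i @` B) => /=.
    by split; [apply: filterS FA|apply: filterS FB] => z Az; exists z.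
  move=> [_ _] [/= [a Aa <-] [b Bb <-]].
  have ab : `|a - b| < d / (`|v| + 1).
    by have := AB (a, b) (conj Aa Bb); rewrite -ball_normE.
  rewrite /ball /= !vP -innerNl -innerDl.
  move: ab; rewrite ltr_pdivlMr ?ltr_wpDl //.
  apply: le_lt_trans; apply: le_trans (norm_inner_le _ _) _.
  by rewrite ler_wpM2l // lerDl.
have [c cP] := choice coordC.
exists (\sum_i c i *: e`_i).
have : \sum_i coord e i x *: e`_i @[x --> F] --> \sum_i c i *: e`_i.
  apply: cvg_big => [|i _]; first exact: add_continuous.
  apply: cvgZr_tmp; exact: cP.
by under eq_fun do rewrite -xE.
Qed.

End InnerProduct.

Lemma adjointP (R : realType) (X Y : euclideanType R) (K : {linear X -> Y})
    (x : X) (y : Y) :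
  inner (K x) y = inner x (adjoint K y).
Proof.
have [|v vP] := @riesz_representation _ _ (fun x => inner (K x) y).
  by move=> a u w; rewrite linearP innerPl.
exact: (@getPex _ [set v | forall x, inner (K x) y = inner x v] (ex_intro _ v vP)).
Qed.

(** * Strong convexity: minimizers, subdifferentials and conjugates *)

Section StrongConvexity.
Context {R : realType} {X : euclideanType R}.
Implicit Types (h : X -> \bar R) (x y z p s v : X) (mu a b t c : R).

Lemma eq_lee (u w : \bar R) : u = w -> (u <= w)%E.
Proof. by move=> ->. Qed.

Lemma eproper_fin h x : eproper h -> (h x < +oo)%E -> exists a, h x = a%:E.
Proof.
move=> [hNy _] hx; exists (fine (h x)); rewrite fineK //.
by rewrite fin_numElt hNy.
Qed.

Lemma eproper_ex h : eproper h -> exists x a, h x = a%:E.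
Proof. by move=> hP; have [x /(eproper_fin hP)[a ha]] := hP.2; exists x, a. Qed.

Lemma strongly_convex_fin mu h x y a b t : strongly_convex mu h ->
  0 < t < 1 -> (h x <= a%:E)%E -> (h y <= b%:E)%E ->
  (h (t *: x + (1 - t) *: y)%R <=
    (t * a + (1 - t) * b - mu / 2 * (t * (1 - t)) * `|x - y| ^+ 2)%:E)%E.
Proof.
move=> hsc t01 hx hy; apply: le_trans (hsc x y t t01) _.
have /andP[t0 t1] := t01.
rewrite [leRHS]EFinB; apply: leeD => //; rewrite [leRHS]EFinD (EFinM t) (EFinM (1 - t)).
apply: leeD.
  by apply: lee_wpmul2l; rewrite // lee_fin ltW.
by apply: lee_wpmul2l; rewrite // lee_fin subr_ge0 ltW.
Qed.

Lemma lsc_ball h x a : lower_semicontinuous h -> (a%:E < h x)%E ->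
  exists2 r, 0 < r & forall y, `|x - y| < r -> (a%:E < h y)%E.
Proof.
move=> hlsc /hlsc[V xV VP].
have [r /= r0 rV] := (nbhs_normP x V).1 xV.
by exists r => // y xy; apply: VP; apply: rV.
Qed.

(** Lower semicontinuity keeps [h] above [a - 1] on a ball around a point [x] of its domain. A very
    low value at a distant [z] would, by strong convexity on the segment from [x] to [z], force a
    value below [a - 1] inside that ball. *)
Lemma strongly_convex_lbound mu h : 0 < mu -> eproper h ->
  lower_semicontinuous h -> strongly_convex mu h ->
  exists m, forall z, (m%:E <= h z)%E.
Proof.
move=> mu0 hP hlsc hsc; have [x [a hx]] := eproper_ex hP.
have [|r r0 rP] := @lsc_ball h x (a - 1) hlsc.
  by rewrite hx lte_fin gtrBl.
pose s : R := r / 2; have s0 : 0 < s by rewrite divr_gt0.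
have mus0 : 0 < (mu * s ^+ 2)^-1 by rewrite invr_gt0 mulr_gt0 ?exprn_gt0.
(* The last term is the [Q] for which AM-GM gives [d <= s * Q + mu / 4 * s * d ^+ 2] uniformly in
   [d]. *)
exists (a - 1 - (mu * s ^+ 2)^-1) => z; rewrite leNgt; apply/negP => hz.
have [xz|xz] := ltP `|x - z| r.
  have := lt_trans (rP _ xz) hz; rewrite lte_fin; lra.
pose d := `|z - x|; have rd : r <= d by rewrite /d distrC.
have d0 : 0 < d by apply: lt_le_trans rd.
(* This places the intermediate point at distance [s = r / 2] from [x]. *)
pose t : R := s / d.
have t0 : 0 < t by rewrite divr_gt0.
have t12 : t <= 1 / 2 by rewrite ler_pdivrMr // /s; lra.
have t01 : 0 < t < 1 by apply/andP; split; lra.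
have hx' : (h x <= a%:E)%E by rewrite hx.
have hw := strongly_convex_fin hsc t01 (ltW hz) hx'.
have td : t * d = s by rewrite /t divfK ?gt_eqF.
have /rP : `|x - (t *: z + (1 - t) *: x)| < r.
  have -> : x - (t *: z + (1 - t) *: x) = t *: (x - z).
    by rewrite scalerBl scale1r scalerBr opprD opprB addrCA [x + _]addrC subrK addrC.
  by rewrite normrZ gtr0_norm // distrC -/d td /s; lra.
move=> /lt_le_trans /(_ hw); rewrite lte_fin -/d => {hw}.
set Q := _^-1; have QE : Q * (mu * s ^+ 2) = 1.
  by rewrite mulVf // gt_eqF // mulr_gt0 ?exprn_gt0.
have le_d : d <= s * Q + mu / 4 * s * d ^+ 2.
  have : 0 <= (mu * s) * (s * Q + mu / 4 * s * d ^+ 2 - d).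
    have -> : (mu * s) * (s * Q + mu / 4 * s * d ^+ 2 - d)
      = (1 - mu * s * d / 2) ^+ 2 + (Q * (mu * s ^+ 2) - 1) by field.
    by rewrite QE subrr addr0 sqr_ge0.
  by rewrite pmulr_rge0 ?mulr_gt0 // subr_ge0.
move=> lt_a.
have le_q : mu / 4 * t * d ^+ 2 <= mu / 2 * (t * (1 - t)) * d ^+ 2.
  rewrite ler_wpM2r ?sqr_ge0 // -subr_ge0.
  have -> : mu / 2 * (t * (1 - t)) - mu / 4 * t = mu * t / 2 * (1 / 2 - t) by field.
  by rewrite mulr_ge0 ?subr_ge0 // divr_ge0 // mulr_ge0 // ltW.
have : 0 < d * (1 - t - t * Q - mu / 4 * t * d ^+ 2).
  by rewrite pmulr_rgt0 //; lra.
have -> : d * (1 - t - t * Q - mu / 4 * t * d ^+ 2) =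
  d - t * d - (t * d) * Q - mu / 4 * (t * d) * d ^+ 2 by ring.
by rewrite td => ?; lra.
Qed.

Lemma strongly_convex_min mu h : 0 < mu -> eproper h ->
  lower_semicontinuous h -> strongly_convex mu h ->
  exists v a, h v = a%:E /\ forall z, (a%:E <= h z)%E.
Proof.
move=> mu0 hP hlsc hsc; have [b bP] := strongly_convex_lbound mu0 hP hlsc hsc.
pose S := [set a | exists z, h z = a%:E].
have Sinf : has_inf S.
  split; first by have [x [a hx]] := eproper_ex hP; exists a, x.
  by exists b => a [z hz]; rewrite -lee_fin -hz.
pose m := inf S.
have hm z : (m%:E <= h z)%E.
  have [hz|] := ltP (h z) +oo%E; last by rewrite leye_eq => /eqP ->; rewrite leey.
  have [a ha] := eproper_fin hP hz; rewrite ha lee_fin.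
  by apply: ge_inf; [exact: Sinf.2|exists z].
(* The filter of near-minimizers plays the role of a minimizing sequence. *)
pose sub e := [set z | (h z < (m + e)%:E)%E].
pose F := filter_from [set e : R | 0 < e] sub.
have sub0 e : 0 < e -> sub e !=set0.
  move=> e0; have [a [z hz] am] := inf_adherent e0 Sinf.
  by exists z; rewrite /sub /= hz lte_fin.
have Fsub e : 0 < e -> F (sub e) by move=> e0; exists e.
have FF : ProperFilter F.
  apply: filter_from_proper => //; apply: filter_from_filter.
    by exists 1; rewrite /= ltr01.
  move=> d e /= d0 e0; exists (Num.min d e); first by rewrite /= lt_min d0.
  by move=> z; rewrite /sub /= => hz; split; apply: (lt_le_trans hz);
    rewrite lee_fin lerD2l ge_min lexx ?orbT.
have Fc : cauchy F.
  apply/cauchy_ballP => e e0.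
  (* At the midpoint, strong convexity yields [mu / 8 * |x - y|^2 <= d], so
     [|x - y|^2 <= e^2 / 2]. *)
  pose d := mu / 16 * e ^+ 2.
  have d0 : 0 < d by rewrite mulr_gt0 ?exprn_gt0 // divr_gt0.
  exists (sub d, sub d) => /=; first by split; exact: Fsub.
  move=> [x y] [/= xd yd]; rewrite -ball_normE /=.
  have h01 : 0 < (1 / 2 : R) < 1 by apply/andP; split; lra.
  have := le_trans (hm _) (strongly_convex_fin hsc h01 (ltW xd) (ltW yd)).
  rewrite lee_fin => le_m.
  rewrite -(ltr_pXn2r (n := 2)) ?nnegrE ?(ltW e0) //.
  move: le_m; rewrite /d => le_m.
  have : mu * `|x - y| ^+ 2 < mu * e ^+ 2.
    have : 0 < mu * e ^+ 2 by rewrite mulr_gt0 ?exprn_gt0.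
    lra.
  by rewrite ltr_pM2l.
have [v Fv] := euclidean_complete FF Fc.
exists v, m; split=> //; apply/eqP; rewrite eq_le hm andbT leNgt; apply/negP => hv.
(* By lower semicontinuity [h] exceeds such an [a] near [v], while the filter converging to [v]
   contains the set where [h < a]. *)
have [a ma av] : exists2 a, m < a & (a%:E < h v)%E.
  have [hv'|] := ltP (h v) +oo%E; last first.
    by rewrite leye_eq => /eqP ->; exists (m + 1); rewrite ?ltry // ltrDl.
  have [b' hb] := eproper_fin hP hv'; move: hv; rewrite hb lte_fin => mb.
  by exists ((m + b') / 2); rewrite ?lte_fin; lra.
have [V vV VP] := hlsc _ _ av.
have [|z [Vz]] := filter_ex (filterI (Fv _ vV) (Fsub (a - m) _)).
  by rewrite subr_gt0.
rewrite /sub /= addrC subrK => hz.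
by have := lt_trans (VP _ Vz) hz; rewrite ltxx.
Qed.

(** An infinite value at an endpoint makes the right-hand side [+oo], because both weights are
    positive. *)
Lemma strongly_convexP mu h : (forall x, -oo < h x)%E ->
  (forall x y a b t, 0 < t < 1 -> h x = a%:E -> h y = b%:E ->
    (h (t *: x + (1 - t) *: y)%R <=
      (t * a + (1 - t) * b - mu / 2 * (t * (1 - t)) * `|x - y| ^+ 2)%:E)%E) ->
  strongly_convex mu h.
Proof.
move=> hNy hfin x y t t01; have /andP[t0 t1] := t01.
have t1' : 0 < 1 - t by rewrite subr_gt0.
move: (hNy x) (hNy y) (hfin x y).
case: (h x) => [a| |] // _; case: (h y) => [b| |] // _ H.
- exact: H.
- by rewrite gt0_muley ?lte_fin // -EFinM addey // leey.
- by rewrite gt0_muley ?lte_fin // -EFinM addye // leey.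
- by rewrite !gt0_muley ?lte_fin // addye // leey.
Qed.

Lemma econvex_strongly_convex h : econvex h -> strongly_convex 0 h.
Proof.
move=> hc x y t t01; apply: le_trans (hc x y t t01) _.
by rewrite !mul0r sube0.
Qed.

Lemma lscD_continuous h (q : X -> R^o) : lower_semicontinuous h -> continuous q ->
  lower_semicontinuous (fun z => h z + (q z)%:E)%E.
Proof.
move=> hlsc qc x a ahq.
have [b ab bh] : exists2 b, a - q x < b & (b%:E < h x)%E.
  move: ahq; case: (h x) => [r|_|//].
    rewrite -EFinD lte_fin => ?.
    by exists ((a - q x + r) / 2); rewrite ?lte_fin; lra.
  by exists (a - q x + 1); rewrite ?ltry // ltrDl.
have [V xV VP] := hlsc _ _ bh.
exists (V `&` [set y | a - b < q y]).
  apply: filterI => //; apply: (cvgr_gt (q x) (qc x)).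
  by lra.
move=> y [/VP by_ /= qy].
have -> : a = b + (a - b) by lra.
by rewrite EFinD lteD // lte_fin.
Qed.

Lemma normr_sqr_continuous : continuous (fun z : X => `|z| ^+ 2 : R^o).
Proof. by move=> z; apply: continuousM; exact: norm_continuous. Qed.

(** Stands in for letting [t] tend to 0 in difference quotients along segments. *)
Lemma le0_of_le_lin (x k : R) : (forall t, 0 < t < 1 -> x <= k * t) -> x <= 0.
Proof.
move=> H; rewrite leNgt; apply/negP => x0.
have k1 : 0 < `|k| + 1 by rewrite ltr_wpDl.
pose t := Num.min (1 / 2) (x / 2 / (`|k| + 1)).
have t0 : 0 < t by rewrite lt_min !divr_gt0.
have t1 : t < 1 by rewrite gt_min; apply/orP; left; lra.
have : x <= (`|k| + 1) * t.
  apply: le_trans (H t _) _; first by rewrite t0 t1.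
  by rewrite ler_wpM2r ?(ltW t0) // (le_trans (ler_norm k)) // lerDl.
have : (`|k| + 1) * t <= x / 2.
  by rewrite mulrC -ler_pdivlMr // ge_min lexx orbT.
lra.
Qed.

Lemma subdifferential_fin h x p : eproper h -> subdifferential h x p ->
  exists a, h x = a%:E.
Proof.
move=> hP hp; apply: eproper_fin => //; have [z [b hz]] := eproper_ex hP.
by have := hp z; rewrite hz; case: (h x) => [r| |] //; rewrite ltry.
Qed.

(** For [c > 0] this is surjectivity of [c + subdifferential h] (Minty), and
    for [c = 0] surjectivity of the subdifferential itself. *)
Lemma strongly_convex_minty mu c h s : 0 <= mu -> 0 < mu + c ->
  eproper h -> lower_semicontinuous h -> strongly_convex mu h ->
  exists v, subdifferential h v (s - c *: v).
Proof.
move=> mu0 muc hP hlsc hsc.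
(* The gradient of [q] at [v] is [c *: v - s], so a minimizer of [h + q] is the point sought. *)
pose q z := c / 2 * `|z| ^+ 2 - inner z s.
have qC : continuous (q : X -> R^o).
  move=> z; apply: cvgB; last exact: inner_continuous.
  by apply: cvgMl_tmp; exact: normr_sqr_continuous.
pose H z := (h z + (q z)%:E)%E.
have HNy z : (-oo < H z)%E.
  by rewrite /H; have := hP.1 z; case: (h z) => [r| |] // _; rewrite -?EFinD ?ltNyr ?addye.
have HP : eproper H.
  split=> //; have [z [a hz]] := eproper_ex hP.
  by exists z; rewrite /H hz -EFinD ltry.
(* Being quadratic, [q] has an exact convexity defect, which adds [c] to the modulus of [h]. *)
have qE x y t : q (t *: x + (1 - t) *: y) = t * q x + (1 - t) * q y
    - c / 2 * (t * (1 - t)) * `|x - y| ^+ 2.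
  by rewrite /q -!inner_norm !innerE (innerC y x); field.
have Hsc : strongly_convex (mu + c) H.
  apply: strongly_convexP => // x y a b t t01.
  move=> /(congr1 (fun u => u - (q x)%:E)%E); rewrite /H addeK // -EFinB => hx.
  move=> /(congr1 (fun u => u - (q y)%:E)%E); rewrite addeK // -EFinB => hy.
  have := strongly_convex_fin hsc t01 (eq_lee hx) (eq_lee hy).
  move=> /(leeD2r (q (t *: x + (1 - t) *: y))%:E) /le_trans; apply.
  by rewrite -EFinD lee_fin qE; lra.
have [v [a [Hv va]]] := strongly_convex_min muc HP (lscD_continuous hlsc qC) Hsc.
have [b hv] : exists b, h v = b%:E.
  apply: eproper_fin => //; rewrite ltNge leye_eq; apply/negP => /eqP hv.
  by move: Hv; rewrite /H hv.
move: Hv; rewrite /H hv -EFinD => -[ab].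
exists v => w; rewrite hv; have := hP.1 w.
case hw: (h w) => [d| |] // _; last by rewrite leey.
rewrite -EFinD lee_fin -subr_le0.
(* Minimality is tested at [t *: w + (1 - t) *: v] and divided by [t]; only the quadratic part of
   [q] leaves a term of order [t]. *)
apply: (@le0_of_le_lin _ (c / 2 * `|w - v| ^+ 2)) => t t01.
have /andP[t0 t1] := t01.
have := le_trans (va (t *: w + (1 - t) *: v))
  (leeD2r _ (strongly_convex_fin hsc t01 (eq_lee hw) (eq_lee hv))).
rewrite -EFinD lee_fin -ab => H1.
have H2 : 0 <= mu / 2 * (t * (1 - t)) * `|w - v| ^+ 2.
  by rewrite !mulr_ge0 ?subr_ge0 ?sqr_ge0 // ltW.
have {H1 H2} : b + q v <= t * d + (1 - t) * b + q (t *: w + (1 - t) *: v) by lra.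
rewrite -subr_ge0 => H1; rewrite -subr_ge0 -(pmulr_rge0 _ t0).
apply: le_trans H1 _.
by rewrite /q -!inner_norm !innerE (innerC v w) (innerC s w) (innerC s v); lra.
Qed.

(** Compare the subgradient inequality with strong convexity at [t *: z + (1 - t) *: x], divide by
    [t], and let [t] tend to 0. *)
Lemma subgradient_strongly_convex mu h x p z a b : strongly_convex mu h ->
  subdifferential h x p -> h x = a%:E -> h z = b%:E ->
  a + inner p (z - x) + mu / 2 * `|z - x| ^+ 2 <= b.
Proof.
move=> hsc hp hx hz; rewrite -subr_le0.
apply: (@le0_of_le_lin _ (mu / 2 * `|z - x| ^+ 2)) => t t01.
have /andP[t0 t1] := t01.
have := le_trans (hp _) (strongly_convex_fin hsc t01 (eq_lee hz) (eq_lee hx)).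
have -> : t *: z + (1 - t) *: x - x = t *: (z - x).
  by rewrite scalerBl scale1r scalerBr addrA addrAC addrK.
rewrite hx -EFinD lee_fin innerZr => H.
rewrite -(ler_pM2l t0); lra.
Qed.

Lemma subdifferential_strong_mono mu h x y p q : eproper h ->
  strongly_convex mu h -> subdifferential h x p -> subdifferential h y q ->
  mu * `|x - y| ^+ 2 <= inner (p - q) (x - y).
Proof.
move=> hP hsc hp hq.
have [a hx] := subdifferential_fin hP hp; have [b hy] := subdifferential_fin hP hq.
have := subgradient_strongly_convex hsc hp hx hy.
have := subgradient_strongly_convex hsc hq hy hx.
rewrite (distrC y x) !innerE; lra.
Qed.

Lemma subdifferential_lipschitz mu h x y p q : 0 < mu -> eproper h ->
  strongly_convex mu h -> subdifferential h x p -> subdifferential h y q ->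
  mu * `|x - y| <= `|p - q|.
Proof.
move=> mu0 hP hsc hp hq.
have [->|xy] := eqVneq x y; first by rewrite subrr normr0 mulr0.
have xy0 : 0 < `|x - y| by rewrite normr_gt0 subr_eq0.
rewrite -(ler_pM2r xy0) -mulrA -expr2.
exact: le_trans (subdifferential_strong_mono hP hsc hp hq) (inner_le_norm _ _).
Qed.

Lemma conjugate_ge h p x : ((inner p x)%:E - h x <= conjugate h p)%E.
Proof. by apply: ereal_sup_ubound; exists x. Qed.

Lemma conjugate_gtNy h p : eproper h -> (-oo < conjugate h p)%E.
Proof.
move=> hP; have [x [a hx]] := eproper_ex hP.
by apply: lt_le_trans (conjugate_ge h p x); rewrite hx ltNyr.
Qed.

(** Equality case of Fenchel-Young: the subgradient inequality says that [x] attains the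
    supremum. *)
Lemma conjugate_subgradient h x p a : subdifferential h x p -> h x = a%:E ->
  conjugate h p = (inner p x - a)%:E.
Proof.
move=> hp hx; apply/eqP; rewrite eq_le; apply/andP; split; last first.
  by rewrite EFinB -hx conjugate_ge.
apply: ge_ereal_sup => _ [z _ <-]; have := hp z; rewrite hx -EFinD innerDr innerNr.
case: (h z) => [b| |] //; last by rewrite leNye.
by rewrite -EFinB !lee_fin; lra.
Qed.

Lemma subdifferential_conjugate h x p : eproper h -> subdifferential h x p ->
  subdifferential (conjugate h) p x.
Proof.
move=> hP hp q; have [a hx] := subdifferential_fin hP hp.
rewrite (conjugate_subgradient hp hx); apply: le_trans (conjugate_ge h q x).
by rewrite hx -EFinB -EFinD lee_fin !innerE (innerC x q) (innerC x p); lra.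
Qed.

(** A supremum of continuous affine functions is lower semicontinuous. *)
Lemma conjugate_lsc h : lower_semicontinuous (conjugate h).
Proof.
move=> p a /ereal_sup_gt[_ [x _ <-]] ax.
have [V pV VP] : exists2 V, nbhs p V &
    forall q, V q -> (a%:E < (inner q x)%:E - h x)%E.
  move: ax; case: (h x) => [b| |] // ax; last by exists setT => //; exact: filterT.
  exists [set q | a + b < inner q x].
    apply: (cvgr_gt _ (@inner_continuous _ _ x p)).
    by move: ax; rewrite -EFinB lte_fin; lra.
  by move=> q /=; rewrite -EFinB lte_fin; lra.
by exists V => // q /VP /lt_le_trans; apply; exact: conjugate_ge.
Qed.

End StrongConvexity.

(** * Existence of gradients *)

Section Gradient.
Context {R : realType} {X : euclideanType R}.
Implicit Types (f h psi : X -> \bar R) (u v x y z p : X) (mu : R).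

Lemma inner_scalar p : scalar (inner p).
Proof. by move=> a x y; rewrite innerDr innerZr. Qed.

Lemma inner_continuousr p : continuous (inner p : X -> R^o).
Proof.
move=> x; have -> : inner p = (fun y => inner y p) by apply/funext => y; rewrite innerC.
exact: inner_continuous.
Qed.

Lemma gradientE h u v : is_gradient h u v -> gradient h u = v.
Proof.
move=> huv; have [_ _ gP] := @getPex _ (is_gradient h u) (ex_intro _ v huv).
have [_ _ vP] := huv; apply/eqP; rewrite -subr_eq0; apply/eqP/inner_eq0.
by rewrite {1}/gradient innerDl innerNl -gP -vP subrr.
Qed.

(** Strong convexity of [psi] turns [v \in subdifferential h u] into a Lipschitz
    selection, so that the first-order remainder is at most [`|z - u|^2 / mu]. *)
Lemma subdifferential_gradient mu h psi : 0 < mu -> eproper psi ->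
  strongly_convex mu psi ->
  (forall u, exists v, [/\ h u \is a fin_num, subdifferential h u v &
                           subdifferential psi v u]) ->
  forall u, subdifferential psi (gradient h u) u.
Proof.
move=> mu0 psiP psisc hP u; have [v [hu huv pvu]] := hP u.
suff huv' : is_gradient h u v by rewrite (gradientE huv').
pose df : {linear X -> R^o} :=
  HB.pack (inner v : X -> R^o)
    (GRing.isLinear.Build _ _ _ _ (inner v : X -> R^o) (inner_scalar v)).
have dfc : continuous df by exact: inner_continuousr.
have fin z : h z \is a fin_num by have [w []] := hP z.
have sub z p w : subdifferential h z p ->
    fine (h z) + inner p (w - z) <= fine (h w).
  by move=> /(_ w); rewrite -{1}(fineK (fin z)) -(fineK (fin w)) -EFinD lee_fin.
have dfE : (fine \o h : X -> R^o) \o shift u = cst (fine (h u) : R^o) + df +o_ 0 id.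
  apply/eqaddoP => e e0; near=> z.
  have [w [_ hw pw]] := hP (z + u).
  (* The two subgradient inequalities place the remainder between 0 and [inner (w - v) z]. *)
  have lo := sub u v (z + u) huv; have hi := sub (z + u) w u hw.
  have lip := subdifferential_lipschitz mu0 psiP psisc pw pvu.
  have zu : u - (z + u) = - z by rewrite opprD addrCA subrr addr0.
  rewrite addrK in lo lip; rewrite zu innerNr in hi.
  change (`|fine (h (z + u)%R) - (fine (h u) + inner v z) : R| <= e * `|z|).
  rewrite ger0_norm; last by rewrite subr_ge0.
  apply: (@le_trans _ _ (inner (w - v) z)).
    by rewrite innerDl innerNl; lra.
  apply: le_trans (inner_le_norm _ _) _; rewrite ler_wpM2r //.
  rewrite -(ler_pM2l mu0); apply: le_trans lip _.
  by near: z; apply: nbhs0_le; rewrite mulr_gt0.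
have diffE := diff_unique dfc dfE.
split; first exact: nearW.
  by apply/diff_locallyP; rewrite diffE.
by move=> z; rewrite diffE.
Unshelve. all: by end_near. Qed.

Lemma conjugate_subdifferentiable mu f : 0 < mu -> eproper f -> econvex f ->
  lower_semicontinuous f -> eproper (conjugate f) ->
  strongly_convex mu (conjugate f) ->
  forall u, exists v, subdifferential f u v /\ subdifferential (conjugate f) v u.
Proof.
move=> mu0 fP fc flsc fsP fssc u.
have mu0' : 0 < mu + 0 by rewrite addr0.
have [w0] := strongly_convex_minty u (ltW mu0) mu0' fsP (@conjugate_lsc _ _ f) fssc.
rewrite scale0r subr0 => uw0; exists w0; split=> // w.
rewrite leNgt; apply/negP => fw.
have [d hd] : exists d, f w = d%:E.
  by apply: eproper_fin => //; apply: lt_le_trans fw _; rewrite leey.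
(* A strict violation at [w] leaves room for [a]; its margin [e] has to absorb the error of
   replacing [w0] by [p]. *)
have [a da af] : exists2 a, d - inner w0 (w - u) < a & (a%:E < f u)%E.
  move: fw; rewrite hd; case: (f u) => [b| |] //; last first.
    by exists (d - inner w0 (w - u) + 1); rewrite ?ltry // ltrDl.
  rewrite -EFinD lte_fin => ?.
  by exists ((b + (d - inner w0 (w - u))) / 2); rewrite ?lte_fin; lra.
have [r r0 rP] := lsc_ball flsc af.
pose e : R := a - (d - inner w0 (w - u)).
have e0 : 0 < e by rewrite subr_gt0.
(* The first summand forces [|u - z| < r], the second [|p - w0| * |w - u| <= e]; the 1 makes [l]
   positive and the first bound strict. *)
pose l : R := `|w0| / r + `|w0| * `|w - u| / (mu * e) + 1.
have l0 : 0 < l by rewrite ltr_wpDl // addr_ge0 // divr_ge0 // ?mulr_ge0 // ltW.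
have lr : `|w0| < l * r.
  rewrite -ltr_pdivrMr // /l.
  have : 0 <= `|w0| * `|w - u| / (mu * e) by rewrite divr_ge0 ?mulr_ge0 // ltW.
  lra.
have le : `|w0| * `|w - u| <= l * mu * e.
  rewrite -mulrA -ler_pdivrMr ?mulr_gt0 // /l.
  have : 0 <= `|w0| / r by rewrite divr_ge0 // ltW.
  lra.
have l0' : 0 < 0 + l by rewrite add0r.
have [z] := strongly_convex_minty (l *: u) (lexx 0) l0' fP flsc
  (econvex_strongly_convex fc).
rewrite -scalerBr; set p := l *: (u - z) => zp.
(* Since [z - u = - l^-1 *: p], this becomes [l * mu * |p - w0|^2 <= inner p (w0 - p)], the source
   of both norm bounds. *)
have := subdifferential_strong_mono fsP fssc (subdifferential_conjugate fP zp) uw0.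
have uz : u - z = l^-1 *: p by rewrite scalerA mulVf ?gt_eqF // scale1r.
clearbody p.
have -> : z - u = - (l^-1 *: p) by rewrite -uz opprB.
rewrite innerNl innerZl -mulrN [leRHS]mulrC ler_pdivlMr // => mono.
have mono0 : 0 <= mu * `|p - w0| ^+ 2 * l.
  by rewrite mulr_ge0 ?(ltW l0) // mulr_ge0 ?sqr_ge0 // ltW.
have p_le : `|p| <= `|w0|.
  have [->|p0] := eqVneq p 0; first by rewrite normr0.
  have pp : 0 < `|p| by rewrite normr_gt0.
  rewrite -(ler_pM2r pp); apply: le_trans (inner_le_norm w0 p).
  by move: (le_trans mono0 mono); rewrite innerDr innerNr inner_norm (innerC p w0); lra.
have pw_le : l * mu * `|p - w0| <= `|w0|.
  have [->|pw] := eqVneq p w0; first by rewrite subrr normr0 mulr0.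
  have pw0 : 0 < `|p - w0| by rewrite normr_gt0 subr_eq0.
  rewrite -(ler_pM2r pw0).
  have := inner_le_norm w0 (w0 - p); rewrite distrC; apply: le_trans.
  have := inner_ge0 (p - w0); move: mono.
  rewrite !innerE. rewrite (innerC p w0); lra.
have /rP az : `|u - z| < r.
  rewrite uz normrZ gtr0_norm ?invr_gt0 // mulrC ltr_pdivrMr // mulrC.
  exact: le_lt_trans lr.
have [b fz] := subdifferential_fin fP zp.
move: az (zp w); rewrite fz hd -EFinD lte_fin lee_fin => ab.
have -> : w - z = (w - u) + l^-1 *: p by rewrite -uz addrA subrK.
have pw0_ge : - (`|p - w0| * `|w - u|) <= inner p (w - u) - inner w0 (w - u).
  by have := inner_le_norm (w0 - p) (w - u); rewrite distrC innerDl innerNl; lra.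
have pp_ge0 : 0 <= l^-1 * inner p p.
  by rewrite mulr_ge0 ?inner_ge0 // invr_ge0 ltW.
(* The subgradient inequality at [z] now gives [d >= f z + inner w0 (w - u) - e], whereas [f z > a]
   makes the right-hand side exceed [d]. *)
rewrite innerDr innerZr => bd.
have : `|p - w0| * `|w - u| <= e.
  rewrite -(ler_pM2l (mulr_gt0 l0 mu0)); apply: le_trans le.
  by rewrite mulrA ler_wpM2r.
by rewrite /e; lra.
Qed.

End Gradient.

(** * Optimality at the saddle point and the error bounds *)

Lemma saddle_point_fin (R : realType) (X Y : euclideanType R) (K : {linear X -> Y})
    (f : Y -> \bar R) (g : X -> \bar R) (xhat : X) (yhat : Y) :
  saddle_point (lagrangian K f g) xhat yhat -> eproper g -> eproper (conjugate f) ->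
  exists a b, g xhat = a%:E /\ conjugate f yhat = b%:E.
Proof.
move=> hat_saddle gP fsP.
have [x0 [a0 gx0]] := eproper_ex gP; have [y0 [b0 fy0]] := eproper_ex fsP.
have [L1 L2] := hat_saddle x0 y0.
(* Comparison with [x0] and [y0] excludes each infinite case; if both values are [+oo], the first
   inequality reads [+oo <= -oo]. *)
move: L1 L2 (gP.1 xhat) (fsP.1 yhat); rewrite /lagrangian gx0 fy0.
case: (g xhat) => [a| |] //; case: (conjugate f yhat) => [b| |] //.
by exists a, b.
Qed.

(** With one variable frozen at the saddle point and its finite value cancelled, the saddle
    inequality is itself the subgradient inequality in the other variable. *)
Lemma saddle_point_subdifferential (R : realType) (X Y : euclideanType R) (K : {linear X -> Y})
    (f : Y -> \bar R) (g : X -> \bar R) (xhat : X) (yhat : Y) :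
  saddle_point (lagrangian K f g) xhat yhat -> eproper g -> eproper (conjugate f) ->
  subdifferential g xhat (- adjoint K yhat) /\
  subdifferential (conjugate f) yhat (K xhat).
Proof.
move=> hat_saddle gP fsP.
have [a [b [ga fb]]] := saddle_point_fin hat_saddle gP fsP.
split=> [x|y]; have := fsP.1; have := gP.1.
  move=> /(_ x); have [_] := hat_saddle x yhat.
  rewrite /lagrangian ga fb; case: (g x) => [c| |] //; last by move=> *; rewrite leey.
  rewrite -!EFinD !lee_fin !(adjointP K) innerNl innerDr innerNr.
  by rewrite !(innerC (adjoint K yhat)); lra.
move=> _ /(_ y); have [+ _] := hat_saddle xhat y.
rewrite /lagrangian ga fb; case: (conjugate f y) => [c| |] //; last by move=> *; rewrite leey.
by rewrite -!EFinD !lee_fin innerDr innerNr; lra.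
Qed.

Lemma norm_le_of_mono (R : realType) (X : euclideanType R) (mu : R) (s d : X) :
  0 < mu -> mu * `|d| ^+ 2 <= inner s d -> `|d| <= `|s| / mu.
Proof.
move=> mu0 sd; rewrite ler_pdivlMr // mulrC.
have [->|d0] := eqVneq d 0; first by rewrite normr0 mulr0.
have dp : 0 < `|d| by rewrite normr_gt0.
rewrite -(ler_pM2r dp) -mulrA -expr2.
exact: le_trans sd (inner_le_norm _ _).
Qed.

Theorem lemma2 (R : realType) (X Y : euclideanType R) (K : {linear X -> Y})
  (f : Y -> \bar R) (g : X -> \bar R) (mu_fs mu_g : R)
  (f_proper : eproper f) (f_convex : econvex f)
  (f_lsc : lower_semicontinuous f)
  (g_proper : eproper g) (g_convex : econvex g)
  (g_lsc : lower_semicontinuous g)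
  (mu_fs_gt0 : 0 < mu_fs) (mu_g_gt0 : 0 < mu_g)
  (fs_strong : strongly_convex mu_fs (conjugate f))
  (g_strong : strongly_convex mu_g g)
  (xhat : X) (yhat : Y)
  (hat_saddle : saddle_point (lagrangian K f g) xhat yhat)
  (hat_unique : forall (x : X) (y : Y),
     saddle_point (lagrangian K f g) x y -> x = xhat /\ y = yhat) :
  forall (x : X) (y : Y),
    (forall p : X, subdifferential g x p ->
       `|x - xhat| <= `|p + adjoint K (gradient f (K x))| / mu_g) /\
    (forall q : Y, subdifferential (conjugate f) y q ->
       `|y - yhat| <=
         `|q - K (gradient (conjugate g) (- adjoint K y))| / mu_fs).

Proof.
move=> x y.
(* If [conjugate f] is constantly [+oo], every point is a saddle point, so
   uniqueness makes [X] and [Y] trivial. *)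
have [fsoo|/existsNP[y0 fsy0]] := pselect (forall y, conjugate f y = +oo%E).
  have sad a b : saddle_point (lagrangian K f g) a b.
    by move=> a' b'; rewrite /lagrangian !fsoo !addeNy.
  have [-> ->] := hat_unique _ _ (sad x y).
  by split=> *; rewrite subrr normr0 divr_ge0 // ltW.
have fsP : eproper (conjugate f).
  split=> [z|]; first exact: conjugate_gtNy.
  by exists y0; rewrite ltey; apply/negP => /eqP.
have [gxhat fyhat] := saddle_point_subdifferential hat_saddle g_proper fsP.
split=> [p gp|q fq]; apply: norm_le_of_mono => //.
  have fKx : subdifferential (conjugate f) (gradient f (K x)) (K x).
    apply: (subdifferential_gradient mu_fs_gt0 fsP fs_strong) => u.
    have [v [fv fsv]] := conjugate_subdifferentiable mu_fs_gt0 f_proper f_convex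
      f_lsc fsP fs_strong u.
    by exists v; split=> //; have [a ->] := subdifferential_fin f_proper fv.
  have := subdifferential_strong_mono g_proper g_strong gp gxhat.
  have := subdifferential_strong_mono fsP fs_strong fKx fyhat.
  set v := gradient f (K x) => H1 H2.
  have H3 : 0 <= mu_fs * `|v - yhat| ^+ 2 by rewrite mulr_ge0 ?sqr_ge0 // ltW.
  move: H2 (le_trans H3 H1).
  by rewrite !innerE !(innerC (adjoint K _)) -!(adjointP K); lra.
set s := - adjoint K y.
have gs : subdifferential g (gradient (conjugate g) s) s.
  (* The function differentiated is [conjugate g], with [g] as strongly convex partner, so
     surjectivity of the subdifferential of [g] suffices. *)
  apply: (subdifferential_gradient mu_g_gt0 g_proper g_strong) => u.
  have mu0 : 0 < mu_g + 0 by rewrite addr0.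
  have [v] := strongly_convex_minty u (ltW mu_g_gt0) mu0 g_proper g_lsc g_strong.
  rewrite scale0r subr0 => gv; exists v; split=> //.
    have [a ga] := subdifferential_fin g_proper gv.
    by rewrite (conjugate_subgradient gv ga).
  exact: subdifferential_conjugate.
have := subdifferential_strong_mono fsP fs_strong fq fyhat.
have := subdifferential_strong_mono g_proper g_strong gs gxhat.
set v := gradient (conjugate g) s => H1 H2.
have H3 : 0 <= mu_g * `|v - xhat| ^+ 2 by rewrite mulr_ge0 ?sqr_ge0 // ltW.
(* The nonnegative term is [<s + K^* yhat, v - xhat> = - <y - yhat, K v - K xhat>]; adding it to
   [H2] replaces [K xhat] by [K v]. *)
move: H2 (le_trans H3 H1).
by rewrite /s !innerE !(innerC (adjoint K _)) -!(adjointP K); lra.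
Qed.
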